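(* Let $N\geq 4$ and let $A$ have full row rank. Suppose that $f\in\mathcal{F}^A_{c_1}(\mathbb{R}^n)$ is $L$-smooth with $c_1>0$ and $g\in\mathcal{F}_{0}(\mathbb{R}^m)$, and let $(x^k,z^k,\lambda^k)_{k=1}^N$ be generated by ADMM with step length $t>0$ from $\lambda^0,z^0$. If $t<\min\left\{c_1, \sqrt{\tfrac{c_1 L}{\lambda_{\min}(AA^T)}}\right\}$, then $$D(\lambda^\star)-D(\lambda^N)\leq \rho\left(1-\tfrac{2c_1 t}{c_1d+2c_1 t+ t^2} \right)^{N},$$ where $d=\tfrac{L}{\lambda_{\min}(AA^T)}$, $\rho=\tfrac{V^0}{16t}\left(1-\tfrac{2c_1 t}{c_1d+2c_1 t+ t^2} \right)^{-4}$ and $V^0=\|\lambda^0-\lambda^\star\|^2+t^2\|z^0-z^\star\|_B^2$.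
   Context: Problem: $\min_{(x,z)\in\mathbb{R}^n\times\mathbb{R}^m} f(x)+g(z)$ subject to $Ax+Bz=b$, where $f:\mathbb{R}^n\to\mathbb{R}\cup\{\infty\}$ and $g:\mathbb{R}^m\to\mathbb{R}\cup\{\infty\}$ are closed proper convex functions, $0\neq A\in\mathbb{R}^{r\times n}$, $0\neq B\in\mathbb{R}^{r\times m}$, $b\in\mathbb{R}^r$. The dual objective is $D(\lambda)=\min_{(x,z)} f(x)+g(z)+\langle\lambda,Ax+Bz-b\rangle$ (value $-\infty$ if unbounded below). Standing assumptions: $(x^\star,z^\star)$ is an optimal solution of the problem with corresponding Lagrange multiplier $\lambda^\star$ (a maximizer of $D$); strong duality holds, i.e. $\max_{\lambda} D(\lambda)=\min_{Ax+Bz=b} f(x)+g(z)$; each subproblem of ADMM attains its minimum. ADMM with step length $t>0$ and starting points $\lambda^0,z^0$: for $k=1,\dots,N$, 1. $x^{k}\in\operatorname{argmin}_x f(x)+\langle\lambda^{k-1},Ax\rangle+\tfrac{t}{2}\|Ax+Bz^{k-1}-b\|^2$; 2. $z^{k}\in\operatorname{argmin}_z g(z)+\langle\lambda^{k-1},Bz\rangle+\tfrac{t}{2}\|Ax^k+Bz-b\|^2$; 3. $\lambda^k=\lambda^{k-1}+t(Ax^k+Bz^k-b)$. Notation: $\|x\|_A=\|Ax\|$, $\|z\|_B=\|Bz\|$ with $\|\cdot\|$ Euclidean; $\lambda_{\min}(M)$ is the smallest eigenvalue of a symmetric matrix $M$. $\mathcal{F}_0(\mathbb{R}^m)$ is the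 set of closed proper convex functions on $\mathbb{R}^m$. $\mathcal{F}^A_{c}(\mathbb{R}^n)$ is the set of closed proper functions $f$ on $\mathbb{R}^n$ that are $c$-strongly convex relative to $\|\cdot\|_A$, i.e. $f-\tfrac{c}{2}\|\cdot\|_A^2$ is convex. A differentiable function $f$ is $L$-smooth if $\|\nabla f(x_1)-\nabla f(x_2)\|\leq L\|x_1-x_2\|$ for all $x_1,x_2$. *)

(* Defs.v *)
(* MathComp / MathComp-Analysis development.  Points of R^n are column vectors
   'cV[R]_n, and functions into R `|` {oo} are functions into \bar R which are
   required (in [proper]) never to take the value -oo. *)
From mathcomp Require Import all_boot all_order all_algebra.
From mathcomp Require Import all_classical all_reals all_analysis.
Import Order.TTheory GRing.Theory Num.Theory.
Import numFieldNormedType.Exports.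

Set Implicit Arguments.
Unset Strict Implicit.
Unset Printing Implicit Defensive.

Local Open Scope classical_set_scope.
Local Open Scope ring_scope.

Section Euclidean.
Variables (R : realType) (n : nat).

Definition inner (u v : 'cV[R]_n) : R := \sum_i u i 0 * v i 0.

(* The library norm `|u| on matrices is the max norm, hence this definition. *)
Definition enorm (u : 'cV[R]_n) : R := Num.sqrt (inner u u).

Definition gradient (F : 'cV[R]_n -> R) (x : 'cV[R]_n) : 'cV[R]_n :=
  \col_i 'D_(delta_mx i 0) F x.

(* For a symmetric M of positive size the set of eigenvalues is finite and
   nonempty, so that this infimum is a minimum. *)
Definition lambda_min (M : 'M[R]_n) : R := inf [set a | eigenvalue M a].

End Euclidean.

Definition seminorm (R : realType) (r n : nat) (A : 'M[R]_(r, n))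
  (x : 'cV[R]_n) : R := enorm (A *m x).

Section FunctionClasses.
Variables (R : realType) (n : nat).
Implicit Type f : 'cV[R]_n -> \bar R.

Definition proper f : Prop :=
  (forall x, f x != -oo%E) /\ (exists x, (f x < +oo)%E).

Definition closed_fun f : Prop :=
  closed [set p : 'cV[R]_n * R | (f p.1 <= p.2%:E)%E].

(* 0 * +oo = 0 in \bar R, so the cases s = 0 and s = 1 are harmless. *)
Definition convex_fun f : Prop :=
  forall (x y : 'cV[R]_n) (s : R), 0 <= s <= 1 ->
    (f (s *: x + (1 - s) *: y)%R <= s%:E * f x + (1 - s)%:E * f y)%E.

Definition closed_proper_convex f : Prop :=
  [/\ closed_fun f, proper f & convex_fun f].

Definition strongly_convex_rel (r : nat) (A : 'M[R]_(r, n)) (c : R) f : Prop :=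
  [/\ closed_fun f, proper f &
      convex_fun (fun x => (f x - (c / 2 * seminorm A x ^+ 2)%:E)%E)].

(* A differentiable function on R^n is in particular finite everywhere. *)
Definition smooth (L : R) f : Prop :=
  let F : 'cV[R]_n -> R := fun x => fine (f x) in
  [/\ forall x, f x \is a fin_num,
      forall x, differentiable F x &
      forall x1 x2, enorm (gradient F x1 - gradient F x2)
                    <= L * enorm (x1 - x2)].

Definition is_argmin f (x : 'cV[R]_n) : Prop := forall y, (f x <= f y)%E.

End FunctionClasses.

Section Problem.
Variables (R : realType) (n m r : nat).
Variables (f : 'cV[R]_n -> \bar R) (g : 'cV[R]_m -> \bar R).
Variables (A : 'M[R]_(r, n)) (B : 'M[R]_(r, m)) (b : 'cV[R]_r).

Definition feasible (x : 'cV[R]_n) (z : 'cV[R]_m) : Prop :=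
  A *m x + B *m z = b.

Definition primal_optimal (x : 'cV[R]_n) (z : 'cV[R]_m) : Prop :=
  feasible x z /\
  (forall x' z', feasible x' z' -> (f x + g z <= f x' + g z')%E).

Definition primal_value : \bar R :=
  ereal_inf [set (f p.1 + g p.2)%E | p in [set p | feasible p.1 p.2]].

Definition dual (lam : 'cV[R]_r) : \bar R :=
  ereal_inf (range (fun p : 'cV[R]_n * 'cV[R]_m =>
    (f p.1 + g p.2 + (inner lam (A *m p.1 + B *m p.2 - b))%:E)%E)).

Definition dual_optimal (lam : 'cV[R]_r) : Prop :=
  forall lam', (dual lam' <= dual lam)%E.

Definition strong_duality : Prop := ereal_sup (range dual) = primal_value.

(* x 0 is not constrained: the starting data are z 0 and lam 0. *)
Definition admm (t : R) (N : nat) (x : nat -> 'cV[R]_n) (z : nat -> 'cV[R]_m)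
    (lam : nat -> 'cV[R]_r) : Prop :=
  forall k, (k < N)%N ->
  [/\ is_argmin (fun u => f u + (inner (lam k) (A *m u)
          + t / 2 * enorm (A *m u + B *m z k - b) ^+ 2)%:E)%E (x k.+1),
      is_argmin (fun v => g v + (inner (lam k) (B *m v)
          + t / 2 * enorm (A *m x k.+1 + B *m v - b) ^+ 2)%:E)%E (z k.+1) &
      lam k.+1 = lam k + t *: (A *m x k.+1 + B *m z k.+1 - b)].

End Problem.

(* Main.v *)
(* Write lam*, x*, z* for the optimal data.  The Lyapunov function
   V_k = |lam_k - lam*|^2 + t^2 |B (z_k - z* )|^2 contracts by the factor q at
   every step: strong convexity relative to A and cocoercivity of the gradient of
   f bound |a|^2 and |v|^2 by multiples of - <v, a>, where a = A (x_{k+1} - x* ) and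
   v + lam* is the multiplier in the optimality condition for x_{k+1}.  On the
   other hand, four consecutive steps already bring the dual gap below V / (16 t);
   this needs only t <= c1 and is a weighted sum of subgradient inequalities whose
   remainder is a sum of squares.  Contracting for N - 4 steps and spending the
   last four on the dual gap gives the rate. *)
Require Import Defs.
From mathcomp Require Import all_boot all_order all_algebra.
From mathcomp Require Import all_classical all_reals all_analysis.
From mathcomp Require Import ring lra.
Import Order.TTheory GRing.Theory Num.Theory.
Import numFieldNormedType.Exports.
Local Open Scope ring_scope.

(** * Euclidean inner product and Cauchy-Schwarz *)

Section InnerProduct.
Context {R : realType} {n : nat}.
Implicit Types (u v w : 'cV[R]_n) (a : R).

Lemma innerC u v : inner u v = inner v u.
Proof. by apply: eq_bigr => i _; rewrite mulrC. Qed.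

Lemma innerDl u v w : inner (u + v) w = inner u w + inner v w.
Proof. by rewrite -big_split; apply: eq_bigr => i _; rewrite mxE mulrDl. Qed.

Lemma innerZl a u v : inner (a *: u) v = a * inner u v.
Proof. by rewrite mulr_sumr; apply: eq_bigr => i _; rewrite mxE mulrA. Qed.

Lemma innerNl u v : inner (- u) v = - inner u v.
Proof. by rewrite -scaleN1r innerZl mulN1r. Qed.

Lemma innerDr u v w : inner u (v + w) = inner u v + inner u w.
Proof. by rewrite !(innerC u) innerDl. Qed.

Lemma innerZr a u v : inner u (a *: v) = a * inner u v.
Proof. by rewrite !(innerC u) innerZl. Qed.

Lemma innerNr u v : inner u (- v) = - inner u v.
Proof. by rewrite !(innerC u) innerNl. Qed.

Definition innerE := (innerDl, innerDr, innerNl, innerNr, innerZl, innerZr).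

Lemma inner_ge0 u : 0 <= inner u u.
Proof. by apply: sumr_ge0 => i _; rewrite -expr2 sqr_ge0. Qed.

Lemma inner_gt0 {u} : u != 0 -> 0 < inner u u.
Proof.
move=> u0; rewrite lt0r inner_ge0 andbT; apply: contra u0 => /eqP u0.
apply/eqP/matrixP => i j; rewrite ord1 mxE; apply/eqP.
rewrite -sqrf_eq0 expr2; apply/eqP.
by apply: (psumr_eq0P _ u0) => // k _; rewrite -expr2 sqr_ge0.
Qed.

Lemma enorm_sqr u : enorm u ^+ 2 = inner u u.
Proof. by rewrite sqr_sqrtr // inner_ge0. Qed.

Lemma enormZ a u : 0 <= a -> enorm (a *: u) = a * enorm u.
Proof.
move=> a0; rewrite /enorm innerZl innerZr mulrA -expr2 sqrtrM ?sqr_ge0 //.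
by rewrite sqrtr_sqr ger0_norm.
Qed.

Lemma inner_sqr_le u v : inner u v ^+ 2 <= inner u u * inner v v.
Proof.
have [->|v0] := eqVneq v 0.
  by rewrite -(scale0r (0 : 'cV[R]_n)) !innerZr !mul0r mulr0 expr0n.
have vv := inner_gt0 v0.
rewrite -subr_ge0 -(pmulr_rge0 _ vv).
have := inner_ge0 (inner v v *: u - inner u v *: v).
by rewrite !innerE (innerC v u); congr (0 <= _); ring.
Qed.

Lemma inner_le_enorm u v : inner u v <= enorm u * enorm v.
Proof.
apply: le_trans (ler_norm _) _; rewrite -sqrtr_sqr /enorm -sqrtrM ?inner_ge0 //.
by rewrite ler_wsqrtr // inner_sqr_le.
Qed.

End InnerProduct.

Lemma inner_mulmxr {R : realType} {r n : nat} (u : 'cV[R]_r) (A : 'M[R]_(r, n))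
  (v : 'cV[R]_n) : inner u (A *m v) = inner (A^T *m u) v.
Proof.
rewrite /inner (eq_bigr (fun i => \sum_j u i 0 * (A i j * v j 0))); last first.
  by move=> i _; rewrite mxE mulr_sumr.
rewrite exchange_big; apply: eq_bigr => j _; rewrite mxE mulr_suml.
by apply: eq_bigr => i _; rewrite mxE; ring.
Qed.

(** * First-order optimality conditions *)

(** Stands in for letting [e] tend to 0 once a variational inequality has been divided by [e]. *)
Lemma ge0_of_linear_perturbation {R : realType} (a b : R) :
  (forall e, 0 < e < 1 -> 0 <= a + e * b) -> 0 <= a.
Proof.
move=> h; rewrite leNgt; apply/negP => a0.
have b0 : 0 < b.
  by rewrite ltNge; apply/negP => b0; have := h 2^-1; lra.
have d0 : 0 < b - a by lra.
(* For this [e], [a + e * b <= a / 2 < 0], because [b / (b - a) <= 1]. *)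
have e0 : 0 < (- a) / (b - a) / 2 < 1.
  rewrite !divr_gt0 //=; last by lra.
  by rewrite ltr_pdivrMr // ltr_pdivrMr //; lra.
have := h _ e0; set e := _ / 2.
have -> : a + e * b = - (- a) + (- a) / 2 * (b / (b - a)).
  by rewrite /e; field; lra.
have : b / (b - a) <= 1 by rewrite ler_pdivrMr //; lra.
nra.
Qed.

(* With s = 0 this is the subgradient inequality at a minimizer of the
   Lagrangian f + <lam, A .>. *)
Lemma augmented_argmin_lower_bound {R : realType} {n r : nat}
  (f : 'cV[R]_n -> \bar R) (A : 'M[R]_(r, n)) (c s : R) (lam w : 'cV[R]_r)
  (x : 'cV[R]_n) :
  (forall y, f y != -oo%E) ->
  convex_fun (fun y => (f y - (c / 2 * seminorm A y ^+ 2)%:E)%E) ->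
  f x \is a fin_num ->
  is_argmin (fun y => (f y + (inner lam (A *m y)
    + s / 2 * enorm (A *m y + w) ^+ 2)%:E)%E) x ->
  forall y, ((fine (f x) - inner (lam + s *: (A *m x + w)) (A *m (y - x))
    + c / 2 * inner (A *m (y - x)) (A *m (y - x)))%:E <= f y)%E.
Proof.
move=> fNy cvx fx xmin y.
case fyE : (f y) => [v| |]; [|by rewrite leey|by move: (fNy y); rewrite fyE].
set ux := fine (f x); have fxE : f x = ux%:E by rewrite fineK.
rewrite lee_fin -subr_ge0; set h := A *m (y - x).
(* Minimality is tested at the point [p] a fraction [e] of the way from [x] to [y]. After division
   by [e], the penalty leaves an error [e * s / 2] and relative strong convexity one of [e * c / 2],
   both times [inner h h]. *)
apply: (@ge0_of_linear_perturbation _ _ ((s + c) / 2 * inner h h)) => e /andP[e0 e1].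
have := cvx y x e; rewrite (ltW e0) (ltW e1) => /(_ isT).
set p := _ *: y + _ => cvxp.
have ApE : A *m p = A *m x + e *: h.
  by rewrite /p /h mulmxDr mulmxBr -!scalemxAr scalerBl scale1r scalerBr addrCA addrA.
have AyE : A *m y = A *m x + h by rewrite /h mulmxBr addrCA subrr addr0.
have := xmin p.
move: cvxp; rewrite fyE fxE; case: (f p) (fNy p) => [fp| |] // _.
rewrite -!EFinB -!EFinM -!EFinD !lee_fin /seminorm !enorm_sqr ApE AyE.
rewrite !innerE => h1 h2.
rewrite -(pmulr_rge0 _ e0); move: h1 h2.
rewrite !(innerC _ h) (innerC w); lra.
Qed.

(** * Smooth functions: descent lemma and cocoercivity *)

Lemma derive_gradient {R : realType} {n : nat} (F : 'cV[R]_n -> R)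
  (x h : 'cV[R]_n) :
  differentiable F x -> 'D_h F x = inner (gradient F x) h.
Proof.
move=> dF; rewrite deriveE // {1}(matrix_sum_delta h) linear_sum /=.
apply: eq_bigr => i _.
rewrite big_ord1 linearZ /= mxE deriveE // -[LHS]/(_ * _) mulrC.
by congr (_ * _).
Qed.

(** The descent lemma. On the segment, subtract from [F] its linear part and the quadratic term: by
    Cauchy-Schwarz and the Lipschitz bound the derivative of the resulting [psi] is nonpositive, so
    the mean value theorem gives [psi 1 <= psi 0]. *)
Lemma smooth_upper_bound {R : realType} {n : nat} (F : 'cV[R]_n -> R) (L : R)
  (x h : 'cV[R]_n) :
  (forall y, differentiable F y) ->
  (forall y1 y2, enorm (gradient F y1 - gradient F y2) <= L * enorm (y1 - y2)) ->
  F (x + h) <= F x + inner (gradient F x) h + L / 2 * inner h h.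
Proof.
move=> dF lipF.
pose line (s : R) := F (x + s *: h).
have dline (s : R) : is_derive s 1 line (inner (gradient F (x + s *: h)) h).
  have slopeE : (fun e : R => e^-1 *: (line (e *: 1 + s) - line s)) =
      (fun e : R => e^-1 *: (F (e *: h + (x + s *: h)) - F (x + s *: h))).
    apply/funext => e; rewrite /line; congr (_ *: (F _ - _)).
    by rewrite -[e *: 1]/(e * 1) mulr1 scalerDl addrCA.
  have := @diff_derivable _ _ _ F (x + s *: h) h (dF _).
  rewrite -(derive_gradient F (x + s *: h) h (dF _)) /derivable /derive => D.
  by split; rewrite /derivable /derive slopeE.
have scaleE (a b : R) : a *: (b : R^o) = a * b by [].
pose psi (s : R) := line s - s * inner (gradient F x) h - s ^+ 2 * (L / 2 * inner h h).
pose dpsi (s : R) := inner (gradient F (x + s *: h)) h - inner (gradient F x) h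
  - s * (L * inner h h).
have dpsiP (s : R) : is_derive s 1 psi (dpsi s).
  have -> : psi = line - inner (gradient F x) h \*: (id : R -> R)
     - (L / 2 * inner h h) \*: ((id : R -> R) ^+ 2).
    by apply/funext => u; rewrite /psi !fctE /= !scaleE; lra.
  apply: is_derive_eq; rewrite /dpsi !scaleE /= expr1; lra.
have psi_cont : ({within `[0%R, 1%R], continuous psi})%classic.
  apply: derivable_within_continuous => s _; exact: ex_derive.
have [s /[!in_itv]/= /andP[s0 s1]] :=
  @MVT _ psi dpsi 0 1 ltr01 (fun s _ => dpsiP s) psi_cont.
rewrite subr0 mulr1 => psiE.
have : dpsi s <= 0.
  rewrite /dpsi -innerNl -innerDl subr_le0.
  apply: le_trans (inner_le_enorm _ _) _.
  have := lipF (x + s *: h) x; rewrite [x + _ - x]addrC addKr enormZ ?(ltW s0) // => hl.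
  apply: le_trans (ler_wpM2r (sqrtr_ge0 _) hl) _.
  by rewrite -[X in _ <= _ * (_ * X)]enorm_sqr /enorm; lra.
rewrite -psiE /psi /line scale1r scale0r addr0; lra.
Qed.

(** At a point near [y], the affine minorant touching at [x] lies below the quadratic majorant of
    [F] around [y]. Adding this to its version with [x] and [y] exchanged gives cocoercivity. *)
Lemma cocoercive_lower_bound {R : realType} {n : nat} (F : 'cV[R]_n -> R) (L : R)
  (x y u v : 'cV[R]_n) :
  0 < L ->
  (forall w, differentiable F w) ->
  (forall w1 w2, enorm (gradient F w1 - gradient F w2) <= L * enorm (w1 - w2)) ->
  (forall w, F x + inner u (w - x) <= F w) ->
  (forall w, F y + inner v (w - y) <= F w) ->
  F x + inner u (y - x) + (2 * L)^-1 * inner (u - v) (u - v) <= F y.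
Proof.
move=> L0 dF lipF subx suby.
(* An affine minorant touching a differentiable function has the gradient as slope; both [k] and
   [- k] are tested. *)
have gradE h : inner (gradient F y) h = inner v h.
  suff key k : 0 <= inner (gradient F y) k - inner v k.
    have := key h; have := key (- h); rewrite !innerNr; lra.
  apply: (@ge0_of_linear_perturbation _ _ (L / 2 * inner k k)) => e /andP[e0 _].
  have := smooth_upper_bound F L y (e *: k) dF lipF.
  have := suby (y + e *: k); rewrite [y + _ - y]addrC addKr !innerE.
  rewrite -(pmulr_rge0 _ e0); lra.
(* This [h] minimizes the majorant around [y] minus the minorant of slope [u]. *)
pose h := L^-1 *: (u - v).
have := smooth_upper_bound F L y h dF lipF; rewrite gradE.
have := subx (y + h); rewrite -addrA addrCA /h.
rewrite ![inner _ (_ *: _)]innerZr ![inner (_ *: _) _]innerZl ![inner u (_ + _)]innerDr.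
rewrite !innerZr.
set d := u - v; have -> : inner u d = inner v d + inner d d.
  by rewrite -innerDl addrC subrK.
have -> : L / 2 * (L^-1 * (L^-1 * inner d d)) = (2 * L)^-1 * inner d d.
  by field; lra.
have -> : (2 * L)^-1 = L^-1 / 2 by rewrite invfM mulrC.
lra.
Qed.

(** * The least eigenvalue of a symmetric matrix *)

Lemma quadratic_form_continuous {R : realType} {n : nat} (M : 'M[R]_n.+1) :
  continuous (fun w : 'rV[R]_n.+1 => inner w^T (M *m w^T)).
Proof.
have -> : (fun w : 'rV[R]_n.+1 => inner w^T (M *m w^T)) =
    (fun w => \sum_i w 0 i * \sum_j M i j * w 0 j).
  apply/funext => w; apply: eq_bigr => i _; rewrite !mxE; congr (_ * _).
  by apply: eq_bigr => j _; rewrite mxE.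
apply: (continuous_big add_continuous) => i _ w.
apply: continuousM; first exact: coord_continuous.
apply: (continuous_big add_continuous) => j _ v.
by apply: continuousM; [exact: cst_continuous | exact: coord_continuous].
Qed.

Lemma compact_unit_sphere {R : realType} {n : nat} :
  compact [set w : 'rV[R]_n.+1 | inner w^T w^T = 1]%classic.
Proof.
apply: bounded_closed_compact.
  exists 1; split => // K K1 w /= w1.
  rewrite [leLHS]/Num.norm /= mx_normrE; apply/bigmax_leP; split => [|[i j] _ /=].
    by rewrite ltW // (lt_trans _ K1).
  rewrite ord1 (le_trans _ (ltW K1)) // -sqrtr_sqr -[leRHS]sqrtr1 ler_wsqrtr //.
  rewrite -w1 /inner (bigD1 j) //= !mxE -expr2 lerDl.
  by apply: sumr_ge0 => k _; rewrite -expr2 sqr_ge0.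
rewrite (_ : [set w | _]%classic =
  (fun w => inner w^T (1%:M *m w^T)) @^-1` [set x | x = 1])%classic; last first.
  by apply/seteqP; split => w /=; rewrite mul1mx.
apply: preimage_closed; last exact: closed_eq.
by move=> w _; exact: quadratic_form_continuous.
Qed.

(** The quadratic form attains a minimum [mu] on the compact unit sphere. Homogeneity extends the
    bound to all vectors, the minimizer is an eigenvector, and no eigenvalue lies below [mu]. Rows
    appear because [EVT_min_rV] and [eigenvalue] speak of row vectors. *)
Lemma symmetric_min_eigenvector {R : realType} {n : nat} (M : 'M[R]_n) :
  (0 < n)%N -> M^T = M ->
  exists v : 'cV[R]_n, [/\ v != 0, M *m v = lambda_min M *: v &
    forall u, lambda_min M * inner u u <= inner u (M *m u)].
Proof.
case: n M => [//|n] M _ symM.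
have S0 : ([set w : 'rV[R]_n.+1 | inner w^T w^T = 1] !=set0)%classic.
  exists (delta_mx 0 0) => /=; rewrite /inner (bigD1 ord0) //= !mxE !eqxx mulr1.
  by rewrite big1 ?addr0 // => i i0; rewrite !mxE (negPf i0) andbF mul0r.
have [c] := EVT_min_rV S0 (@compact_unit_sphere R n)
  (continuous_subspaceT (quadratic_form_continuous M)).
rewrite inE /= => c1 cmin; set mu := inner c^T (M *m c^T) in cmin.
have Rayleigh u : mu * inner u u <= inner u (M *m u).
  have [->|u0] := eqVneq u 0.
    by rewrite -(scale0r (0 : 'cV[R]_n.+1)) !innerZl !mul0r mulr0.
  have uu := inner_gt0 u0; have uN : 0 < enorm u by rewrite sqrtr_gt0.
  have := cmin ((enorm u)^-1 *: u)^T; rewrite inE /= trmxK innerZl innerZr.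
  rewrite -enorm_sqr expr2 mulKf ?gt_eqF // mulVf ?gt_eqF // => /(_ erefl).
  rewrite -scalemxAr innerZl innerZr => h.
  have -> : inner u (M *m u) =
      enorm u ^+ 2 * ((enorm u)^-1 * ((enorm u)^-1 * inner u (M *m u))).
    by field; rewrite gt_eqF.
  by rewrite mulrC ler_wpM2l ?sqr_ge0.
have symMC (u v : 'cV[R]_n.+1) : inner u (M *m v) = inner v (M *m u).
  by rewrite inner_mulmxr symM innerC.
have Mc : M *m c^T = mu *: c^T.
  (* The Rayleigh inequality is an equality at [c^T], so its first variation in each direction is
     nonnegative; taking minus the residual as direction makes the residual vanish. *)
  have key h : 0 <= inner (M *m c^T - mu *: c^T) h.
    apply: (@ge0_of_linear_perturbation _ _
      ((inner h (M *m h) - mu * inner h h) / 2)) => e /andP[e0 _].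
    have := Rayleigh (c^T + e *: h).
    rewrite mulmxDr -scalemxAr !innerE -/mu c1 (symMC c^T h) (innerC c^T h) => hh.
    rewrite -(pmulr_rge0 _ e0); move: hh; rewrite (innerC (M *m _) h). lra.
  have := key (- (M *m c^T - mu *: c^T)); rewrite innerNr oppr_ge0.
  move=> le0; apply/eqP; rewrite -subr_eq0; apply: contraTT le0 => /inner_gt0.
  by rewrite ltNge.
have c0 : c^T != 0.
  apply: contra_eq_neq c1 => ->.
  by rewrite -(scale0r (0 : 'cV[R]_n.+1)) innerZl mul0r eq_sym oner_eq0.
have eigM : eigenvalue M mu.
  apply/eigenvalueP; exists c; last by apply: contra c0 => /eqP ->; rewrite trmx0.
  by apply: trmx_inj; rewrite trmx_mul symM Mc linearZ.
have lbM : lbound [set a | eigenvalue M a]%classic mu.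
  move=> a /= /eigenvalueP[w wM w0].
  have := Rayleigh w^T; rewrite -[M]symM -trmx_mul wM linearZ innerZr ler_pM2r //.
  by apply: inner_gt0; apply: contra w0 => /eqP h; rewrite -[w]trmxK h trmx0.
have -> : lambda_min M = mu.
  apply/le_anti/andP; split; first by apply: ge_inf => //; exists mu.
  by apply: lb_le_inf => //; exists mu.
by exists c^T.
Qed.

(** * The dual gap after four steps *)

(* The weights come from a dual solution of the performance-estimation
   semidefinite program for four steps, the squares from an LDL^T
   factorization of its slack matrix. *)
Lemma four_step_sos {R : realFieldType} (u s0 p1 s1 p2 s2 p3 s3 p4 s4 ph : R) :
  let u1 := u - p1 - s1 in let u2 := u1 - p2 - s2 in
  let u3 := u2 - p3 - s3 in let u4 := u3 - p4 - s4 in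
  let v1 := u - p1 - s0 in let v2 := u1 - p2 - s1 in
  let v3 := u2 - p3 - s2 in let v4 := u3 - p4 - s3 in
  0 <= 16^-1 * (u * u + s0 * s0) - u4 * (ph + s4)
    + 40^-1 * (ph * ph) + 16^-1 * (p1 * p1) + 12^-1 * (p2 * p2)
    + 10^-1 * (p3 * p3) + 11 / 48 * (p4 * p4)
    + 8^-1 * (v1 * (p4 - p1) + 2^-1 * ((p4 - p1) * (p4 - p1)))
    + 6^-1 * (v2 * (p4 - p2) + 2^-1 * ((p4 - p2) * (p4 - p2)))
    + 5^-1 * (v3 * (ph - p3) + 2^-1 * ((ph - p3) * (ph - p3)))
    + 3 / 4 * (v4 * (ph - p4) + 2^-1 * ((ph - p4) * (ph - p4)))
    + 7^-1 * (u1 * (s2 - s1)) + 2 / 3 * (u2 * (s3 - s2))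
    + u3 * (s4 - s3) + 2^-1 * (u4 * (s2 - s4)).
Proof.
move=> /=.
have h1 := sqr_ge0 (- u / 6 + p1 / 6 + s1 / 6 + p2 / 6 - s2 / 12 + p3 / 2 + s3
  + 3 / 4 * p4 + s4 / 4 - ph / 4).
have h2 := sqr_ge0 (u - p1 - 44 / 35 * s1 - 8 / 5 * p2 - 26 / 35 * s2
  - 12 / 25 * p3 - 3 * p4 - 6 * s4 - 48 / 25 * ph).
have h3 := sqr_ge0 (- 2 / 7 * s1 - 2 / 3 * p2 - 5 / 7 * s2 + 2 / 15 * p3
  - p4 / 3 + s4 + 13 / 15 * ph).
have h4 := sqr_ge0 (s1 / 4 + p2 - s2 / 4 + p3 / 20 - 15 / 16 * p4 + 41 / 80 * ph).
have h5 := sqr_ge0 (s0 + p1 - p4).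
have h6 := sqr_ge0 (- s1 + s2 - 7 / 215 * p3 + 161 / 172 * p4 - 287 / 860 * ph).
have h7 := sqr_ge0 (p4 - 59 / 675 * p3 - 457 / 1350 * ph).
have h8 := sqr_ge0 (ph - 2062 / 9137 * p3).
have h9 := sqr_ge0 p1; have h10 := sqr_ge0 p3.
lra.
Qed.

(** Abstract form of the last four steps: [l], [b], [a] are deviations from the optimum, [F] and [G]
    the excesses of the two Lagrangian parts, and [ah], [Fh] belong to an arbitrary competitor in
    the dual infimum. *)
Lemma four_step_gap {R : realType} {r : nat} (t : R) (l b a : nat -> 'cV[R]_r)
  (F G : nat -> R) (ah : 'cV[R]_r) (Fh : R) :
  let v k := l k + t *: (a k.+1 + b k) in
  0 < t ->
  (forall k, (k < 4)%N -> l k.+1 = l k + t *: (a k.+1 + b k.+1)) ->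
  t / 2 * inner ah ah <= Fh ->
  (forall k, (k < 4)%N -> t / 2 * inner (a k.+1) (a k.+1) <= F k.+1) ->
  (forall k, (k < 4)%N -> F k.+1 - inner (v k) (ah - a k.+1)
    + t / 2 * inner (ah - a k.+1) (ah - a k.+1) <= Fh) ->
  (forall k, (k < 4)%N -> F k.+1 - inner (v k) (a 4%N - a k.+1)
    + t / 2 * inner (a 4%N - a k.+1) (a 4%N - a k.+1) <= F 4%N) ->
  (forall k, (k < 4)%N -> 0 <= G k.+1) ->
  (forall j k, (j < 4)%N -> (k < 4)%N ->
    G k.+1 - inner (l k.+1) (b j.+1 - b k.+1) <= G j.+1) ->
  0 <= Fh + G 4%N + inner (l 4%N) (ah + b 4%N)
    + (inner (l 0%N) (l 0%N) + t ^+ 2 * inner (b 0%N) (b 0%N)) / (16 * t).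
Proof.
move=> v t0 lE Fh0 F0 FFh FF4 G0 GG.
(* Weights: 1/8, 1/6 on [FF4]; 1/5, 3/4 on [FFh]; 1/7, 2/3, 1, 1/2 on [GG]. Those on [Fh0], [F0] and
   [G0] are chosen so that only [Fh + G 4] survives among the function values; [key] is the
   remaining quadratic inequality. *)
suff key : 0 <= (16 * t)^-1 * inner (l 0%N) (l 0%N) + t / 16 * inner (b 0%N) (b 0%N)
    + inner (l 4%N) (ah + b 4%N) + t / 40 * inner ah ah
    + t / 16 * inner (a 1%N) (a 1%N) + t / 12 * inner (a 2%N) (a 2%N)
    + t / 10 * inner (a 3%N) (a 3%N) + t * 11 / 48 * inner (a 4%N) (a 4%N)
    + - 8^-1 * inner (v 0%N) (a 4%N - a 1%N)
    + t / 16 * inner (a 4%N - a 1%N) (a 4%N - a 1%N)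
    + - 6^-1 * inner (v 1%N) (a 4%N - a 2%N)
    + t / 12 * inner (a 4%N - a 2%N) (a 4%N - a 2%N)
    + - 5^-1 * inner (v 2%N) (ah - a 3%N) + t / 10 * inner (ah - a 3%N) (ah - a 3%N)
    + - (3 / 4) * inner (v 3%N) (ah - a 4%N) + t * 3 / 8 * inner (ah - a 4%N) (ah - a 4%N)
    + - 7^-1 * inner (l 1%N) (b 2%N - b 1%N) + - (2 / 3) * inner (l 2%N) (b 3%N - b 2%N)
    + -1 * inner (l 3%N) (b 4%N - b 3%N) + - 2^-1 * inner (l 4%N) (b 2%N - b 4%N).
  have -> : (inner (l 0%N) (l 0%N) + t ^+ 2 * inner (b 0%N) (b 0%N)) / (16 * t)
      = (16 * t)^-1 * inner (l 0%N) (l 0%N) + t / 16 * inner (b 0%N) (b 0%N).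
    by field; rewrite gt_eqF.
  have := F0 0%N isT; have := F0 1%N isT; have := F0 2%N isT; have := F0 3%N isT.
  have := FF4 0%N isT; have := FF4 1%N isT; have := FFh 2%N isT; have := FFh 3%N isT.
  have := G0 0%N isT; have := G0 1%N isT; have := G0 2%N isT; have := G0 3%N isT.
  have := GG 1%N 0%N isT isT; have := GG 2%N 1%N isT isT.
  have := GG 3%N 2%N isT isT; have := GG 1%N 3%N isT isT.
  lra.
rewrite /inner !mulr_sumr -!big_split /=; apply: sumr_ge0 => i _.
rewrite /v !lE // !mxE.
(* The inequality splits over coordinates. Dividing the multiplier by [t] and changing the signs of
   [a], [b], [ah] turns each summand into [t] times the scalar form. *)
pose u := t^-1 * l 0%N i 0.
have -> : l 0%N i 0 = t * u by rewrite mulVKf ?gt_eqF.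
have := mulr_ge0 (ltW t0) (four_step_sos u (- b 0%N i 0) (- a 1%N i 0) (- b 1%N i 0)
  (- a 2%N i 0) (- b 2%N i 0) (- a 3%N i 0) (- b 3%N i 0) (- a 4%N i 0)
  (- b 4%N i 0) (- ah i 0)).
by congr (0 <= _); field; rewrite gt_eqF.
Qed.

(** * Contraction of the Lyapunov function in one step *)

(* The bounds on <v, a> combine into
   |v - t a|^2 <= (d / t + 2 + t / c) (- t <v, a>), and this constant is
   2 / (1 - q). *)
Lemma contraction_step {R : realType} {r : nat} (t c d : R) (l0 l1 a b0 b1 : 'cV[R]_r) :
  let v := l0 + t *: (a + b0) in
  let q := 1 - 2 * c * t / (c * d + 2 * c * t + t ^+ 2) in
  0 < t -> t < c -> c <= d ->
  l1 = l0 + t *: (a + b1) ->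
  inner v a <= - (c * inner a a) ->
  inner v v <= - (d * inner v a) ->
  inner l1 b1 <= 0 ->
  inner l1 l1 + t ^+ 2 * inner b1 b1
    <= q * (inner l0 l0 + t ^+ 2 * inner b0 b0).
Proof.
move=> v q t0 tc cd l1E va vv lb.
set D := c * d + 2 * c * t + t ^+ 2.
have D0 : 0 < D by rewrite /D; nra.
have qD : q * D = D - 2 * c * t by rewrite /q mulrBl mul1r divfK ?gt_eqF.
have q0 : 0 < q by rewrite -(pmulr_lgt0 _ D0) qD /D; nra.
(* [(2 * q - 1) * D = c * d - 2 * c * t + t ^+ 2], which is at least [(c - t) ^+ 2] since
   [c <= d]. *)
have q2 : 0 < 2 * q - 1 by rewrite -(pmulr_lgt0 _ D0) mulrBl -mulrA qD /D; nra.
have va0 : inner v a <= 0 by have := inner_ge0 a; nra.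
have l0E : l0 = v - t *: a - t *: b0.
  by apply/matrixP => i j; rewrite !mxE; ring.
(* [v - t *: b0] equals [l1 - t *: b1], whose cross term has the right sign by [lb]. *)
apply: (@le_trans _ _ (inner (v - t *: b0) (v - t *: b0))).
  have -> : v - t *: b0 = l1 - t *: b1.
    by apply/matrixP => i j; rewrite l1E !mxE; ring.
  by rewrite !innerE (innerC b1); nra.
(* Completing the square in [t *: b0], whose coefficient is [2 * q - 1], leaves exactly [q] times
   [gap]. *)
clearbody v; have sq := inner_ge0 (q *: (v - t *: a) - v - (2 * q - 1) *: (t *: b0)).
have gap : (1 - q) * inner (v - t *: a) (v - t *: a) <= - (2 * t * inner v a).
  have -> : 1 - q = 2 * c * t / D by rewrite /q opprB addrCA subrr addr0.
  rewrite mulrAC ler_pdivrMr // !innerE (innerC a) /D.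
  have h1 : 2 * c * t * inner v v <= 2 * c * t * - (d * inner v a).
    by rewrite ler_wpM2l //; nra.
  have h2 : 2 * t ^+ 3 * inner v a <= 2 * t ^+ 3 * - (c * inner a a).
    by rewrite ler_wpM2l // mulr_ge0 // exprn_ge0 // ltW.
  lra.
rewrite -subr_ge0 -(pmulr_rge0 _ q2).
move: sq gap; rewrite {}l0E !innerE (innerC a v) !(innerC b0 _).
move=> sq /(ler_wpM2l (ltW q0)) gap; lra.
Qed.

(** * The saddle point given by strong duality *)

Section SaddlePoint.
Context {R : realType} {n m r : nat}.
Context {f : 'cV[R]_n -> \bar R} {g : 'cV[R]_m -> \bar R}.
Context {A : 'M[R]_(r, n)} {B : 'M[R]_(r, m)} {b : 'cV[R]_r}.

Lemma dual_le lam x z :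
  (dual f g A B b lam <= f x + g z + (inner lam (A *m x + B *m z - b))%:E)%E.
Proof. by apply: ereal_inf_lbound; exists (x, z). Qed.

Lemma dual_optimal_value lams xs zs :
  primal_optimal f g A B b xs zs -> dual_optimal f g A B b lams ->
  strong_duality f g A B b -> dual f g A B b lams = (f xs + g zs)%E.
Proof.
move=> [feas opt] dopt sd.
have -> : dual f g A B b lams = ereal_sup (range (dual f g A B b)).
  apply/le_anti/andP; split; first by apply: ereal_sup_ubound; exists lams.
  by apply: ge_ereal_sup => _ [lam _ <-].
rewrite sd; apply/le_anti/andP; split.
  by apply: ereal_inf_lbound; exists (xs, zs).
by apply: le_ereal_inf_tmp => _ [[x z] /= ? <-]; exact: opt.
Qed.

(** The optimal value equals the dual value at [lams], which is at most the Lagrangian at [xs] and a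
    point where [g] is finite. *)
Lemma optimal_fin_num lams xs zs :
  (forall x, f x \is a fin_num) -> Defs.proper g ->
  primal_optimal f g A B b xs zs -> dual_optimal f g A B b lams ->
  strong_duality f g A B b -> g zs \is a fin_num.
Proof.
move=> ffin [gNy [z0 gz0]] opt dopt sd.
have := dual_le lams xs z0; rewrite (dual_optimal_value _ _ _ opt dopt sd).
move: (gNy zs) (gNy z0) gz0; rewrite -(fineK (ffin xs)).
by case: (g zs) => [?| |] //; case: (g z0).
Qed.

Lemma saddle_inequality lams xs zs x z :
  (forall x, f x \is a fin_num) -> Defs.proper g ->
  primal_optimal f g A B b xs zs -> dual_optimal f g A B b lams ->
  strong_duality f g A B b -> g z \is a fin_num ->
  fine (f xs) + fine (g zs)
    <= fine (f x) + fine (g z) + inner lams (A *m x + B *m z - b).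
Proof.
move=> ffin gp opt dopt sd gz; have gzs := optimal_fin_num _ _ _ ffin gp opt dopt sd.
have := dual_le lams x z; rewrite (dual_optimal_value _ _ _ opt dopt sd).
by rewrite -(fineK (ffin xs)) -(fineK (ffin x)) -(fineK gz) -(fineK gzs) -!EFinD lee_fin.
Qed.

End SaddlePoint.

(** * Subgradient inequalities expressed through multipliers *)

Lemma convex_fun_lower_bound {R : realType} {n r : nat}
  (g : 'cV[R]_n -> \bar R) (A : 'M[R]_(r, n)) (s : R) (lam w : 'cV[R]_r)
  (x : 'cV[R]_n) :
  Defs.proper g -> convex_fun g ->
  is_argmin (fun y => (g y + (inner lam (A *m y)
    + s / 2 * enorm (A *m y + w) ^+ 2)%:E)%E) x ->
  g x \is a fin_num /\
  forall y, ((fine (g x) - inner (lam + s *: (A *m x + w)) (A *m (y - x)))%:E <= g y)%E.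
Proof.
move=> [gNy [y0 gy0]] cvx xmin.
have gx : g x \is a fin_num.
  move: (xmin y0) (gNy x) (gNy y0) gy0.
  by case: (g x) => [?| |] //; case: (g y0).
split=> // y.
have := @augmented_argmin_lower_bound _ _ _ g A 0 s lam w x gNy _ gx xmin y.
rewrite mul0r mul0r addr0; apply.
move: cvx; rewrite (_ : (fun z => _) = g) //.
by apply/funext => z; rewrite !mul0r sube0.
Qed.

(** The minorants have slopes [- A^T *m mu] and [- A^T *m nu]. The two cocoercive bounds are added,
    and the lower bound [s] on [A *m A^T] passes from these slopes back to the multipliers. *)
Lemma relative_cocoercivity {R : realType} {n r : nat} (F : 'cV[R]_n -> R)
  (A : 'M[R]_(r, n)) (L s : R) (x y : 'cV[R]_n) (mu nu : 'cV[R]_r) :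
  0 < L -> 0 < s ->
  (forall w, differentiable F w) ->
  (forall w1 w2, enorm (gradient F w1 - gradient F w2) <= L * enorm (w1 - w2)) ->
  (forall u, s * inner u u <= inner u (A *m A^T *m u)) ->
  (forall w, F x - inner mu (A *m (w - x)) <= F w) ->
  (forall w, F y - inner nu (A *m (w - y)) <= F w) ->
  inner (mu - nu) (mu - nu) <= - (L / s * inner (mu - nu) (A *m (x - y))).
Proof.
move=> L0 s0 dF lipF Ray subx suby.
have negT (u : 'cV[R]_r) (w : 'cV[R]_n) : inner (- (A^T *m u)) w = - inner u (A *m w).
  by rewrite innerNl -inner_mulmxr.
have subx' w : F x + inner (- (A^T *m mu)) (w - x) <= F w by rewrite negT subx.
have suby' w : F y + inner (- (A^T *m nu)) (w - y) <= F w by rewrite negT suby.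
have sqE (u w : 'cV[R]_r) :
    inner (- (A^T *m u) - - (A^T *m w)) (- (A^T *m u) - - (A^T *m w)) =
    inner (u - w) (A *m A^T *m (u - w)).
  by rewrite -opprD innerNl innerNr opprK -mulmxBr -mulmxA [RHS]inner_mulmxr.
have := cocoercive_lower_bound F L x y _ _ L0 dF lipF subx' suby'.
have := cocoercive_lower_bound F L y x _ _ L0 dF lipF suby' subx'.
rewrite !negT (sqE mu) (sqE nu) -(opprB mu nu) mulmxN innerNl innerNr opprK.
have := Ray (mu - nu); set D := inner (mu - nu) (A *m A^T *m _) => RayD.
have -> : inner mu (A *m (y - x)) = - inner mu (A *m (x - y)).
  by rewrite -innerNr -mulmxN opprB.
move=> h1 h2.
have h : L^-1 * D <= - inner (mu - nu) (A *m (x - y)).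
  by rewrite innerDl innerNl; move: h1 h2; rewrite invfM; lra.
rewrite -mulrN mulrAC ler_pdivlMr // mulrC (le_trans RayD) // mulrC.
by rewrite -ler_pdivrMr // mulrC.
Qed.

(** Minorant and majorant are compared at [x + h] and [x - h]; the linear terms cancel in the
    sum. *)
Lemma strong_convexity_le_smoothness {R : realType} {n r : nat}
  (F : 'cV[R]_n -> R) (A : 'M[R]_(r, n)) (c L : R) (x : 'cV[R]_n)
  (mu : 'cV[R]_r) (h : 'cV[R]_n) :
  (forall w, differentiable F w) ->
  (forall w1 w2, enorm (gradient F w1 - gradient F w2) <= L * enorm (w1 - w2)) ->
  (forall y, F x - inner mu (A *m (y - x))
    + c / 2 * inner (A *m (y - x)) (A *m (y - x)) <= F y) ->
  c * inner (A *m h) (A *m h) <= L * inner h h.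
Proof.
move=> dF lipF lbF.
have ub k := smooth_upper_bound F L x k dF lipF.
have := le_trans (lbF (x + h)) (ub h); have := le_trans (lbF (x - h)) (ub (- h)).
rewrite ![x + _]addrC !addrK !mulmxN !innerNr !innerNl !opprK; lra.
Qed.

(** * The linear rate for the dual objective *)

Theorem theorem8 (R : realType) (n m r : nat)
  (f : 'cV[R]_n -> \bar R) (g : 'cV[R]_m -> \bar R)
  (A : 'M[R]_(r, n)) (B : 'M[R]_(r, m)) (b : 'cV[R]_r)
  (c1 L t : R) (N : nat)
  (x : nat -> 'cV[R]_n) (z : nat -> 'cV[R]_m) (lam : nat -> 'cV[R]_r)
  (xs : 'cV[R]_n) (zs : 'cV[R]_m) (lams : 'cV[R]_r)
  (hA0 : A != 0) (hB0 : B != 0)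
  (hopt : primal_optimal f g A B b xs zs)
  (hdual : dual_optimal f g A B b lams)
  (hsd : strong_duality f g A B b)
  (hN : (4 <= N)%N)
  (hA : row_free A)
  (hc1 : 0 < c1)
  (hf : strongly_convex_rel A c1 f)
  (hL : smooth L f)
  (hg : closed_proper_convex g)
  (ht0 : 0 < t)
  (hadmm : admm f g A B b t N x z lam)
  (ht : t < Num.min c1 (Num.sqrt (c1 * L / lambda_min (A *m A^T)))) :
  let d := L / lambda_min (A *m A^T) in
  let q := 1 - 2 * c1 * t / (c1 * d + 2 * c1 * t + t ^+ 2) in
  let V0 := enorm (lam 0%N - lams) ^+ 2
            + t ^+ 2 * seminorm B (z 0%N - zs) ^+ 2 in
  let rho := V0 / (16 * t) * q ^- 4 in
  (dual f g A B b lams - dual f g A B b (lam N) <= (rho * q ^+ N)%:E)%E.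
Proof.
cbv zeta; set mE := lambda_min _; set d := L / _; set q := 1 - _ / (c1 * d + _ + _).
set V0 := _ ^+ 2 + t ^+ 2 * _.
have [_ [fNy _] fcvx] := hf; have [ffin dF lipF] := hL; have [_ gp gcvx] := hg.
have tc : t < c1 by move: ht; rewrite lt_min => /andP[].
have feas : A *m xs + B *m zs = b by case: hopt.
have gzs := optimal_fin_num _ _ _ ffin gp hopt hdual hsd.
have dualE : dual f g A B b lams = (fine (f xs) + fine (g zs))%:E.
  by rewrite EFinD !fineK //; exact: dual_optimal_value.
set F := fun y => fine (f y) in dF lipF.
have fE y : f y = (F y)%:E by rewrite fineK.
have r0 : (0 < r)%N.
  by rewrite lt0n; apply: contraNneq hA0 => r0; apply/eqP; subst r; exact: flatmx0.
have symM : (A *m A^T)^T = A *m A^T by rewrite trmx_mul trmxK.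
have [v [v0 vE Ray]] := symmetric_min_eigenvector _ r0 symM.
have Av0 : A^T *m v != 0.
  apply: contra v0 => /eqP Av; rewrite -[v]trmxK -(inj_eq trmx_inj) trmxK trmx0.
  by rewrite -(mulmx_free_eq0 _ hA) -(inj_eq trmx_inj) trmx_mul trmxK trmx0 Av.
have AvE : inner (A^T *m v) (A^T *m v) = mE * inner v v.
  by rewrite -innerZr -vE -mulmxA [RHS]inner_mulmxr.
(* Full row rank makes [A^T] injective, so [A^T *m v] is nonzero at the least eigenvector [v]. *)
have mE0 : 0 < mE.
  by rewrite -(pmulr_lgt0 _ (inner_gt0 v0)) -AvE inner_gt0.
have fs y : F xs - inner lams (A *m (y - xs))
    + c1 / 2 * inner (A *m (y - xs)) (A *m (y - xs)) <= F y.
  (* The saddle inequality with second argument [zs], in the format of an augmented subproblem with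
     zero penalty. *)
  have xsmin : is_argmin (fun u => (f u + (inner lams (A *m u)
      + 0 / 2 * enorm (A *m u + 0) ^+ 2)%:E)%E) xs.
    move=> u; have := saddle_inequality _ _ _ u _ ffin gp hopt hdual hsd gzs.
    rewrite !fE -!EFinD lee_fin !mul0r !addr0 -feas opprD addrACA subrr addr0.
    rewrite innerDr innerNr /F; lra.
  have := augmented_argmin_lower_bound _ _ _ _ _ _ _ fNy fcvx (ffin xs) xsmin y.
  by rewrite scale0r addr0 (fE y) lee_fin.
have gs y : g y \is a fin_num ->
    fine (g zs) - inner lams (B *m (y - zs)) <= fine (g y).
  move=> gy; have := saddle_inequality _ _ _ xs _ ffin gp hopt hdual hsd gy.
  rewrite -feas opprD addrACA subrr add0r -mulmxBr; lra.
(* The test direction [A^T *m v] gives [c1 * mE ^+ 2 <= L * mE] after division by [inner v v]. *)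
have c1L : c1 * mE <= L.
  have := strong_convexity_le_smoothness _ _ _ _ _ _ (A^T *m v) dF lipF fs.
  rewrite mulmxA vE innerZl innerZr AvE -/mE => h.
  have vv := inner_gt0 v0.
  by rewrite -(ler_pM2r mE0) -(ler_pM2r vv); move: h; rewrite !mulrA.
have L0 : 0 < L by rewrite (lt_le_trans _ c1L) // mulr_gt0.
have cd : c1 <= d by rewrite ler_pdivlMr.
pose a k := A *m (x k - xs); pose bb k := B *m (z k - zs); pose l k := lam k - lams.
pose w k := l k + t *: (a k.+1 + bb k).
have ABb u k : A *m u + B *m z k - b = A *m (u - xs) + bb k.
  by rewrite /bb -feas opprD addrACA !mulmxBr.
have fk k y : (k < N)%N -> F (x k.+1) - inner (lams + w k) (A *m (y - x k.+1))
    + c1 / 2 * inner (A *m (y - x k.+1)) (A *m (y - x k.+1)) <= F y.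
  move=> kN; have [xmin _ _] := hadmm k kN.
  have := augmented_argmin_lower_bound f A c1 t (lam k) (B *m z k - b) (x k.+1)
    fNy fcvx (ffin _).
  rewrite addrA ABb -/(a k.+1) => /(_ _ y); rewrite (fE y) lee_fin.
  have -> : lam k + t *: (a k.+1 + bb k) = lams + w k.
    by rewrite /w /l addrA addrCA subrr addr0.
  by apply=> u /=; rewrite !addrA; exact: xmin.
have lE k : (k < N)%N -> l k.+1 = l k + t *: (a k.+1 + bb k.+1).
  by move=> kN; have [_ _ lamE] := hadmm k kN; rewrite /l lamE ABb addrAC.
have gk k : (k < N)%N -> g (z k.+1) \is a fin_num /\
    forall y, ((fine (g (z k.+1)) - inner (lam k.+1) (B *m (y - z k.+1)))%:E <= g y)%E.
  move=> kN; have [_ zmin lamE] := hadmm k kN.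
  have lamE' : lam k.+1 = lam k + t *: (B *m z k.+1 + (A *m x k.+1 - b)).
    by rewrite lamE addrA (addrC (B *m _)).
  rewrite lamE'; apply: (convex_fun_lower_bound g B t (lam k)) => // u /=.
  have swap y : B *m y + (A *m x k.+1 - b) = A *m x k.+1 + B *m y - b.
    by rewrite addrA (addrC (B *m _)).
  by rewrite !swap; exact: zmin.
have gfin k : (k < N)%N -> g (z k.+1) \is a fin_num by move=> /gk[].
have gle k y : (k < N)%N -> g y \is a fin_num ->
    fine (g (z k.+1)) - inner (lam k.+1) (B *m (y - z k.+1)) <= fine (g y).
  by move=> kN gy; have [_ /(_ y)] := gk k kN; rewrite -lee_fin (fineK gy).
have c_half (u : 'cV[R]_r) : t / 2 * inner u u <= c1 / 2 * inner u u.
  by rewrite ler_wpM2r ?inner_ge0 // ler_wpM2r // ltW.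
have step k : (k < N)%N -> inner (l k.+1) (l k.+1) + t ^+ 2 * inner (bb k.+1) (bb k.+1)
    <= q * (inner (l k) (l k) + t ^+ 2 * inner (bb k) (bb k)).
  move=> kN; apply: (@contraction_step _ _ t c1 d (l k) (l k.+1) (a k.+1)) => //.
  - exact: lE.
  (* Adding the strong convexity inequalities at [x k.+1] and at [xs] doubles [c1 / 2]. *)
  - have := fk k xs kN; have := fs (x k.+1).
    rewrite -/(a k.+1) -(opprB (x k.+1) xs) mulmxN -/(a k.+1).
    rewrite -/(w k) !innerNl !innerNr opprK innerDl; lra.
  - have wE : w k = lams + w k - lams by rewrite addrAC subrr add0r.
    rewrite -/(w k) wE; apply: (relative_cocoercivity F A) => // [y|y].
      apply: le_trans (fk k y kN); rewrite lerDl mulr_ge0 ?inner_ge0 //; lra.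
    apply: le_trans (fs y); rewrite lerDl mulr_ge0 ?inner_ge0 //; lra.
  (* Monotonicity of the subdifferential of [g] between [z k.+1] and [zs]. *)
  - have := gle k zs kN gzs; have := gs _ (gfin k kN).
    rewrite -/(bb k.+1) -(opprB (z k.+1) zs) mulmxN -/(bb k.+1).
    rewrite /l innerDl !innerNr innerNl; lra.
pose V k := inner (l k) (l k) + t ^+ 2 * inner (bb k) (bb k).
have q0 : 0 < q.
  have D0 : 0 < c1 * d + 2 * c1 * t + t ^+ 2 by nra.
  by rewrite subr_gt0 ltr_pdivrMr // mul1r; nra.
have Vle k : (k <= N)%N -> V k <= q ^+ k * V 0%N.
  elim: k => [|k IH] kN; first by rewrite expr0 mul1r.
  apply: le_trans (step k kN) _; rewrite (exprS q) -[leRHS]mulrA.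
  by apply: ler_wpM2l; [exact: ltW | exact/IH/ltnW].
have NE : (4 + (N - 4))%N = N by rewrite subnKC.
set M := (N - 4)%N in NE; clearbody M.
have ltMN k : (k < 4)%N -> (k + M < N)%N.
  by move=> k4; rewrite -[X in (_ < X)%N]NE ltn_add2r.
have rhoE : V0 / (16 * t) * q ^- 4 * q ^+ N = q ^+ M * V 0%N / (16 * t).
  have -> : V0 = V 0%N by rewrite /V0 /V /seminorm !enorm_sqr.
  rewrite -NE exprD mulrA mulfVK ?expf_neq0 ?gt_eqF //.
  by rewrite mulrAC (mulrC _ (V 0%N)).
rewrite rhoE lee_subel_addr // dualE addeC -leeBlDr //.
(* The dual value at [lam N] is an infimum, so the Lagrangian is bounded below at every pair
   [(y, u)]. *)
apply: le_ereal_inf_tmp => _ [[y u] _ <-] /=.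
case gu : (g u) (gp.1 u) => [G| |] // _; last by rewrite (fE y); exact: leey.
have gufin : g u \is a fin_num by rewrite gu.
rewrite (fE y) -EFinB -!EFinD lee_fin.
have lamsB p p' : inner lams (p - p') = inner lams p - inner lams p'.
  by rewrite innerDr innerNr.
have aB y' k : A *m (y' - x k) = A *m (y' - xs) - a k.
  by rewrite /a -mulmxBr opprB addrA subrK.
have bB y' k : B *m (y' - z k) = B *m (y' - zs) - bb k.
  by rewrite /bb -mulmxBr opprB addrA subrK.
have fgap k y' : (k < N)%N ->
    F (x k.+1) - F xs + inner lams (a k.+1)
      - inner (w k) (A *m (y' - xs) - a k.+1)
      + t / 2 * inner (A *m (y' - xs) - a k.+1) (A *m (y' - xs) - a k.+1)
    <= F y' - F xs + inner lams (A *m (y' - xs)).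
  move=> /(fk k y'); rewrite aB innerDl lamsB.
  have := c_half (A *m (y' - xs) - a k.+1); lra.
have fsgap y' : t / 2 * inner (A *m (y' - xs)) (A *m (y' - xs))
    <= F y' - F xs + inner lams (A *m (y' - xs)).
  have := fs y'; have := c_half (A *m (y' - xs)); lra.
(* The four-step bound starts at index [M] with competitor [y]; [c_half] has weakened [c1] to [t] in
   its premises. *)
have gap : 0 <= (F y - F xs + inner lams (A *m (y - xs)))
    + (fine (g (z (4 + M)%N)) - fine (g zs) + inner lams (bb (4 + M)%N))
    + inner (l (4 + M)%N) (A *m (y - xs) + bb (4 + M)%N) + V M / (16 * t).
  apply: (@four_step_gap R r t (fun k => l (k + M)%N) (fun k => bb (k + M)%N)
    (fun k => a (k + M)%N)
    (fun k => F (x (k + M)%N) - F xs + inner lams (a (k + M)%N))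
    (fun k => fine (g (z (k + M)%N)) - fine (g zs) + inner lams (bb (k + M)%N)))
    => //= [k k4|k k4|k k4|k k4|k k4|j k j4 k4].
  - exact/lE/ltMN.
  - exact: fsgap.
  - exact/fgap/ltMN.
  - exact/fgap/ltMN.
  - have := gs _ (gfin _ (ltMN _ k4)); rewrite -/(bb (k + M).+1) addSn; lra.
  - have := gle _ _ (ltMN _ k4) (gfin _ (ltMN _ j4)).
    rewrite !addSn bB -/(bb (j + M).+1) -[lam _](subrK lams) -/(l _) innerDl.
    rewrite (lamsB (bb (j + M).+1)); lra.
(* Since [z N] minimizes [g] plus the linear term of [lam N], the arbitrary [u] can be replaced by
   [z N]. *)
have := gle _ u (ltMN 3%N isT) gufin.
rewrite bB gu /= -[(3 + M).+1]/(4 + M)%N => gN.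
have VM : V M / (16 * t) <= q ^+ M * V 0%N / (16 * t).
  by rewrite ler_pM2r ?invr_gt0 ?mulr_gt0 // Vle // -NE leq_addl.
have -> : A *m y + B *m u - b = A *m (y - xs) + B *m (u - zs).
  by rewrite -feas opprD addrACA !mulmxBr.
move: gap VM gN; rewrite -NE /l -/(F xs).
rewrite !(innerDl, innerDr, innerNl, innerNr); lra.
Qed.
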